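(* Let $n\ge 1$ be an integer, let $0<s<1$, and let $\gamma(n,s)>0$ be the number determined by $$\gamma(n,s)\int_{\mathbb R^n}\frac{1-\cos(z_n)}{|z|^{n+2s}}\,dz=1 .$$ Then $$\gamma(n,s)=\frac{s\,2^{2s}\,\Gamma\left(\frac{n+2s}{2}\right)}{\pi^{\frac n2}\,\Gamma(1-s)} .$$
   Context: $z_n$ denotes the last coordinate of $z=(z_1,\dots,z_n)\in\mathbb R^n$, and $\Gamma$ is Euler's gamma function. *)

(* Defs.v *)
From HB Require Import structures.
From mathcomp Require Import all_boot all_order all_algebra.
From mathcomp Require Import all_classical all_reals all_analysis.
Set Implicit Arguments.
Unset Strict Implicit.
Unset Printing Implicit Defensive.
Import Order.TTheory GRing.Theory Num.Theory.
Import numFieldNormedType.Exports.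
Local Open Scope classical_set_scope.
Local Open Scope ring_scope.

(* R^n is rendered as n.-tuple R, with the product sigma-algebra supplied by
   the library.  The library has no n-dimensional Lebesgue measure: it is built
   here by recursion on n, as the image of the product measure
   lebesgue_measure \x lebesgue_tuple n under (x, z) |-> (x, z_1, ..., z_n).
   lebesgue_tuple_box below is the characterization on boxes. *)

Definition tuple_cons (R : realType) (n : nat) (p : R * n.-tuple R) :
  n.+1.-tuple R := [the n.+1.-tuple R of p.1 :: p.2].

Lemma measurable_tuple_cons (R : realType) (n : nat) :
  measurable_fun [set: R * n.-tuple R] (@tuple_cons R n).
Proof. exact: (measurable_cons measurable_fst measurable_snd). Qed.

Section lebesgue_tuple_step.
Context (R : realType) (n : nat).
Variable mu : {sigma_finite_measure set (n.-tuple R) -> \bar R}.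
Local Open Scope ereal_scope.

Definition lebesgue_tuple_step : set (n.+1.-tuple R) -> \bar R :=
  pushforward (@lebesgue_measure R \x mu) (@tuple_cons R n).

Let mcons : measurable_fun [set: measurableTypeR R * n.-tuple R]
  (@tuple_cons R n).
Proof. exact: measurable_tuple_cons. Qed.

Let step0 : lebesgue_tuple_step set0 = 0.
Proof. by rewrite /lebesgue_tuple_step /pushforward preimage_set0 measure0. Qed.

Let step_ge0 A : 0 <= lebesgue_tuple_step A.
Proof. exact: measure_ge0. Qed.

Let step_sigma_additive : semi_sigma_additive lebesgue_tuple_step.
Proof.
move=> F mF tF mUF; rewrite /lebesgue_tuple_step /pushforward preimage_bigcup.
apply: measure_semi_sigma_additive.
- by move=> i; rewrite -[X in measurable X]setTI; exact: mcons.
- apply/trivIsetP => /= i j _ _ ij; rewrite -preimage_setI.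
  by move/trivIsetP : tF => /(_ _ _ _ _ ij) ->//; rewrite preimage_set0.
- by rewrite -preimage_bigcup -[X in measurable X]setTI; exact: mcons.
Qed.

HB.instance Definition _ := isMeasure.Build _ _ _ lebesgue_tuple_step
  step0 step_ge0 step_sigma_additive.

Lemma lebesgue_tuple_stepE (A : set R) (B : set (n.-tuple R)) :
  measurable A -> measurable B ->
  lebesgue_tuple_step
    [set z : n.+1.-tuple R | A (thead z) /\ B [tuple of behead z]] =
  lebesgue_measure A * mu B.
Proof.
move=> mA mB; rewrite -(product_measure1E lebesgue_measure mu mA mB).
rewrite /lebesgue_tuple_step /pushforward; congr (_ _).
have consK (x : R) (z : n.-tuple R) :
    [tuple of behead (tuple_cons (x, z))] = z by apply/val_inj.
by apply/seteqP; split=> -[x z] /=; rewrite theadE consK.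
Qed.

Let step_sigma_finite : sigma_finite setT lebesgue_tuple_step.
Proof.
have /sigma_finiteP[F [TF ndF Foo]] := sigma_finiteT (@lebesgue_measure R).
have /sigma_finiteP[G [TG ndG Goo]] := sigma_finiteT mu.
exists (fun k => [set z : n.+1.-tuple R |
    F k (thead z) /\ G k [tuple of behead z]]).
  apply/esym/seteqP; split=> // z _.
  have [i _ Fi] : (\bigcup_i F i) (thead z) by rewrite -TF.
  have [j _ Gj] : (\bigcup_i G i) [tuple of behead z] by rewrite -TG.
  exists (maxn i j) => //; split.
  - by move: (thead z) Fi; exact/subsetPset/ndF/leq_maxl.
  - by move: [tuple of behead z] Gj; exact/subsetPset/ndG/leq_maxr.
move=> k; have [mF Foo_k] := Foo k; have [mG Goo_k] := Goo k; split.
  apply: measurableI; rewrite -[X in measurable X]setTI.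
    exact: (@measurable_tnth _ (measurableTypeR R) n.+1 ord0).
  exact: measurable_behead.
by rewrite lebesgue_tuple_stepE// lte_mul_pinfty// ge0_fin_numE.
Qed.

HB.instance Definition _ := Measure_isSigmaFinite.Build _ _ _
  lebesgue_tuple_step step_sigma_finite.

End lebesgue_tuple_step.

Fixpoint lebesgue_tuple (R : realType) (n : nat) :
    {sigma_finite_measure set (n.-tuple R) -> \bar R} :=
  match n with
  | 0 => \d_([tuple] : 0.-tuple R)
  | m.+1 => lebesgue_tuple_step (lebesgue_tuple R m)
  end.

Lemma lebesgue_tuple_box (R : realType) (n : nat) (A : 'I_n -> set R) :
  (forall i, measurable (A i)) ->
  lebesgue_tuple R n [set z | forall i, A i (tnth z i)] =
  (\prod_(i < n) lebesgue_measure (A i))%E.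
Proof.
elim: n A => [|n IHn] A mA.
  rewrite big_ord0 /= diracE mem_set//=; first by case.
rewrite big_ord_recl -IHn//=.
have mB : measurable [set z : n.-tuple R | forall i, A (lift ord0 i) (tnth z i)].
  rewrite (_ : [set _ | _] = \bigcap_(i in [set: 'I_n])
      ((fun z : n.-tuple R => tnth z i) @^-1` A (lift ord0 i))).
    apply: fin_bigcap_measurable => // i _.
    by rewrite -[X in measurable X]setTI; exact: measurable_tnth.
  by apply/seteqP; split=> [z Az i _|z Az i]; [exact: Az|exact: (Az i I)].
rewrite -lebesgue_tuple_stepE//; congr (lebesgue_tuple_step _ _).
have tnth_behead (z : n.+1.-tuple R) i :
    tnth [tuple of behead z] i = tnth z (lift ord0 i).
  by rewrite [in RHS](tuple_eta z) tnthS.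
apply/seteqP; split=> z /= => [Az|[A0 AS] i].
  by split=> [|i]; [exact: Az|rewrite tnth_behead; exact: Az].
by have [j ->|->//] := unliftP ord0 i; rewrite -tnth_behead; exact: AS.
Qed.

Definition euclidean_norm (R : realType) (n : nat) (z : n.-tuple R) : R :=
  Num.sqrt (\sum_(i < n) tnth z i ^+ 2).

(* Euler's integral, meaningful for x > 0. *)
Definition Gamma (R : realType) (x : R) : R :=
  \int[lebesgue_measure]_(t in `]0, +oo[) (t `^ (x - 1) * expR (- t)).

(* Main.v *)
(** Put [a = (n + 2s) / 2] and let [I] be the integral of the statement.  The
    change of variables [t = |z|^2 / (4w)] in Euler's integral writes
    [Gamma a * |z|^(-2a)] as [4^(-a)] times the integral of
    [w^(-a-1) exp(-|z|^2 / (4w))] over [w > 0].  By Tonelli, [Gamma a * I] becomes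
    an integral over [w] of Gaussian integrals, and the one-dimensional Fourier
    transform of the Gaussian gives
      [\int (1 - cos z_n) exp(-|z|^2 / (4w)) dz = (4 pi w)^(n/2) (1 - exp(-w))].
    What is left is the integral of [w^(-s-1) (1 - exp(-w))], which equals
    [Gamma (1 - s) / s] by Tonelli again, as [1 - exp(-w)] is the integral of
    [exp(-v)] over [0 < v < w]. *)
Require Import Defs.
From mathcomp Require Import all_boot all_order all_algebra.
From mathcomp Require Import all_classical all_reals all_analysis.
From mathcomp Require Import measurable_realfun ring lra.
Import Order.TTheory GRing.Theory Num.Theory.
Import numFieldNormedType.Exports.
Local Open Scope classical_set_scope.
Local Open Scope ring_scope.

(** * One-dimensional Gaussian integrals and the cosine transform *)

(** The normal density with mean 0 and variance [1/(2c)] has mass 1; its peak constant is moved to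
    the other side. *)
Lemma integral_gauss (R : realType) (c : R) : 0 < c ->
  (\int[lebesgue_measure]_x (expR (- (c * x ^+ 2)))%:E)%E =
  (Num.sqrt (pi / c))%:E.
Proof.
move=> c0; pose s := Num.sqrt (2 * c)^-1.
have s2 : s ^+ 2 = (2 * c)^-1 by rewrite sqr_sqrtr// invr_ge0 mulr_ge0// ltW.
have s0 : s != 0 by rewrite gt_eqF// sqrtr_gt0 invr_gt0 mulr_gt0.
have peak0 : 0 < normal_peak s by exact: normal_peak_gt0.
have := integral_normal_pdf 0 s.
under eq_integral => x _.
  rewrite normal_pdfE// /normal_fun subr0 s2.
  rewrite (_ : - x ^+ 2 / _ = - (c * x ^+ 2)); last by field; rewrite ?gt_eqF.
  rewrite EFinM; over.
rewrite ge0_integralZl_EFin//=; last 2 first.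
- apply/measurable_EFinP; apply: measurableT_comp => //=.
  by apply: measurableT_comp => //=; exact: measurable_funM.
- exact: normal_peak_ge0.
set I := (\int[_]_x _)%E => peakI.
have -> : I = ((normal_peak s)^-1%:E * ((normal_peak s)%:E * I))%E.
  by rewrite muleA -EFinM mulVf ?gt_eqF// mul1e.
rewrite peakI mule1 /normal_peak invrK; congr (Num.sqrt _)%:E.
by rewrite s2; field; lra.
Qed.

Lemma integrable_gauss (R : realType) (c : R) : 0 < c ->
  lebesgue_measure.-integrable [set: R] (fun x => (expR (- (c * x ^+ 2)))%:E).
Proof.
move=> c0; apply/integrableP; split.
  apply/measurable_EFinP; apply: measurableT_comp => //=.
  by apply: measurableT_comp => //=; exact: measurable_funM.
under eq_integral do rewrite gee0_abs ?lee_fin ?expR_ge0//.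
by rewrite integral_gauss// ltry.
Qed.

(** Provides the dominating function for differentiating a cosine transform under the integral sign.
    Half of the exponent absorbs [|x|]: [exp(c x^2/2) >= 1 + c x^2/2], and the product of this bound
    with [1 + 2/c] is at least [1 + x^2], hence at least [|x|]. *)
Lemma integrable_mul_gauss (R : realType) (c : R) : 0 < c ->
  lebesgue_measure.-integrable [set: R]
    (fun x => (`|x| * expR (- (c * x ^+ 2)))%:E).
Proof.
move=> c0.
apply: (@le_integrable _ _ R lebesgue_measure _ measurableT _
    (fun x => ((1 + 2 / c)%:E * (expR (- (c / 2 * x ^+ 2)))%:E)%E)).
- apply/measurable_EFinP; apply: measurable_funM => //=.
  apply: measurableT_comp => //=.
  by apply: measurableT_comp => //=; exact: measurable_funM.
- move=> x _ /=; rewrite lee_fin.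
  have d0 : 0 < 2 / c by rewrite divr_gt0.
  have d1 : 0 <= 1 + 2 / c by rewrite addr_ge0 ?ltW.
  rewrite !normrM normr_id !(ger0_norm (expR_ge0 _)) (ger0_norm d1).
  rewrite (_ : - (c * x ^+ 2) = - (c / 2 * x ^+ 2) + - (c / 2 * x ^+ 2)); last first.
    by field.
  rewrite expRD mulrA ler_wpM2r ?expR_ge0//.
  rewrite [in leLHS]expRN ler_pdivrMr ?expR_gt0//.
  apply: (@le_trans _ _ ((1 + 2 / c) * (1 + c / 2 * x ^+ 2))); last first.
    by rewrite ler_wpM2l ?expR_ge1Dx//; lra.
  have -> : (1 + 2 / c) * (1 + c / 2 * x ^+ 2) =
      1 + 2 / c + c / 2 * x ^+ 2 + x ^+ 2 by field; rewrite ?gt_eqF.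
  have : 0 <= c / 2 * x ^+ 2 by rewrite mulr_ge0 ?sqr_ge0// divr_ge0// ltW.
  rewrite -(real_normK (num_real x)).
  (* This square gives [|x| <= x^2 + 1/4]. *)
  move: d0; have := sqr_ge0 (`|x| - 2^-1).
  set y := `|x|; set u := _ / c; set v := c / 2 * _ => ? ? ?; nra.
- by apply: integrableZl => //; apply: integrable_gauss; lra.
Qed.

(** On growing symmetric intervals the integral is a difference of boundary values of [F], which
    tends to 0; dominated convergence, with bound [|f|], identifies the limit with the integral over
    the line. *)
Lemma integral_derive_eq0 (R : realType) (F f : R -> R) :
  (forall x : R, is_derive x (1 : R) F (f x)) -> continuous f ->
  lebesgue_measure.-integrable [set: R] (EFin \o f) ->
  F n%:R @[n --> \oo] --> 0 -> F (- n%:R) @[n --> \oo] --> 0 ->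
  (\int[lebesgue_measure]_x (f x)%:E = 0)%E.
Proof.
move=> dF cf intf Fy FNy.
have cF : continuous F.
  by move=> x; apply/differentiable_continuous/derivable1_diffP.
(* The successor keeps the interval nondegenerate, as the fundamental theorem of calculus
   requires. *)
pose I n : set R := `[- n.+1%:R, n.+1%:R]%classic.
have FTC n : (\int[lebesgue_measure]_(x in I n) (f x)%:E =
    (F n.+1%:R - F (- n.+1%:R))%:E)%E.
  rewrite /I (@continuous_FTC2 _ _ F) ?EFinB//.
  - by rewrite gtrN.
  - exact: continuous_subspaceT.
  - split; first by move=> x _; exact: ex_derive.
    + exact/cvg_at_right_filter/cF.
    + exact/cvg_at_left_filter/cF.
  - by move=> x _; rewrite derive1E derive_val.
have lim0 : (\int[lebesgue_measure]_(x in I n) (f x)%:E)%E @[n --> \oo] --> 0%E.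
  under eq_fun do rewrite FTC.
  apply: cvg_EFin; first exact: nearW.
  rewrite -[X in _ --> X](subr0 0); apply: cvgB.
  - by rewrite (cvg_shiftS (fun n => F n%:R)).
  - by rewrite (cvg_shiftS (fun n => F (- n%:R))).
have mf : measurable_fun setT (EFin \o f).
  by apply/measurable_EFinP; exact: continuous_measurable_fun.
have limf : (\int[lebesgue_measure]_x ((EFin \o f) \_ (I n)) x)%E @[n --> \oo] -->
    (\int[lebesgue_measure]_x (f x)%:E)%E.
  apply: (@dominated_cvg _ _ R lebesgue_measure _ measurableT
    (fun n => (EFin \o f) \_ (I n)) _ (fun x => `|(f x)%:E|%E)) => //.
  - move=> n; apply/(measurable_restrictT _ _).1.
      exact: measurable_itv.
    exact: measurable_funTS.
  - move=> x _; apply: cvg_near_cst; near=> n.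
    rewrite patchE ifT// inE/= /I/= in_itv/= -ler_norml.
    rewrite (@le_trans _ _ n%:R) ?ler_nat//.
    by near: n; exact: nbhs_infty_ger.
  - exact: integrable_abse.
  - move=> n x _; rewrite patchE; case: ifPn; rewrite ?abse0 ?abse_ge0//.
move: lim0; under eq_fun do rewrite integral_mkcond.
by move=> lim0; exact: (cvg_unique (@ereal_hausdorff R) limf lim0).
Unshelve. all: end_near. Qed.

(* [phi b = \int cos(b x) exp(-c x^2) dx] satisfies [phi' = - b / (2c) phi], the
   integral of the derivative of [sin(b x) exp(-c x^2)] being zero. *)
Lemma integral_cos_gauss (R : realType) (c : R) : 0 < c ->
  \int[lebesgue_measure]_x (cos x * expR (- (c * x ^+ 2))) =
  Num.sqrt (pi / c) * expR (- (4 * c)^-1).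
Proof.
move=> c0.
pose f (b x : R) := cos (b * x) * expR (- (c * x ^+ 2)).
pose phi b := \int[lebesgue_measure]_x f b x.
have mg : measurable_fun [set: R] (fun x : R => expR (- (c * x ^+ 2))).
  apply: measurableT_comp => //=.
  by apply: measurableT_comp => //=; exact: measurable_funM.
have mtrig (h : R -> R) b : continuous h ->
    measurable_fun [set: R] (fun x => h (b * x)).
  move=> ch; apply: measurableT_comp; first exact: continuous_measurable_fun.
  exact: measurable_funM.
have intf b : lebesgue_measure.-integrable [set: R] (EFin \o f b).
  apply: (@le_integrable _ _ R lebesgue_measure _ measurableT _
    (fun x => (expR (- (c * x ^+ 2)))%:E)).
  - apply/measurable_EFinP; apply: measurable_funM => //.
    exact: (mtrig cos b (@continuous_cos R)).
  - move=> x _ /=; rewrite lee_fin normrM ler_piMl// ler_norml.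
    by rewrite cos_le1 cos_geN1.
  - exact: integrable_gauss.
have intxsin b : lebesgue_measure.-integrable [set: R]
    (EFin \o (fun x => x * sin (b * x) * expR (- (c * x ^+ 2)))).
  apply: (@le_integrable _ _ R lebesgue_measure _ measurableT _
    (fun x => (`|x| * expR (- (c * x ^+ 2)))%:E)).
  - apply/measurable_EFinP; apply: measurable_funM => //.
    by apply: measurable_funM => //; exact: (mtrig sin b (@continuous_sin R)).
  - move=> x _ /=; rewrite lee_fin !normrM normr_id ler_wpM2r//.
    rewrite ler_piMr// ler_norml.
    by rewrite sin_le1 sin_geN1.
  - exact: integrable_mul_gauss.
have parts b : b * phi b =
    2 * c * \int[lebesgue_measure]_x (x * sin (b * x) * expR (- (c * x ^+ 2))).
  pose F x := sin (b * x) * expR (- (c * x ^+ 2)).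
  have dF (x : R) : is_derive x (1 : R) F
      (b * f b x - 2 * c * (x * sin (b * x) * expR (- (c * x ^+ 2)))).
    rewrite /F /f; apply: is_derive_eq; rewrite /GRing.scale/=; ring.
  (* Both ends of the line are treated at once, with [u n] equal to [n] or [-n]. For [n >= 1],
     [|F (u n)| <= exp(-c n^2) <= exp(-c)^n]. *)
  have F0 (u : R^nat) : (forall n, u n ^+ 2 = n%:R ^+ 2) ->
      F (u n) @[n --> \oo] --> 0.
    move=> uE; apply: norm_cvg0.
    apply: (@squeeze_cvgr _ _ _ _ (cst 0) (fun n => expR (- c) ^+ n)).
    - near=> n; rewrite normr_ge0/= normrM (ger0_norm (expR_ge0 _)) uE.
      rewrite (@le_trans _ _ (expR (- (c * n%:R ^+ 2))))//.
        by rewrite ler_piMl ?expR_ge0// ler_norml sin_le1 sin_geN1.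
      rewrite -expRM_natl ler_expR mulrN lerN2 mulrC (ler_wpM2l (ltW c0))//.
      rewrite -natrX ler_nat -{1}(expn1 n) leq_pexp2l//.
      by near: n; exact: nbhs_infty_gt.
    - exact: cvg_cst.
    - by apply: cvg_expr; rewrite ger0_norm ?expR_ge0// -expR0 ltr_expR oppr_lt0.
  have /eqP : \int[lebesgue_measure]_x
      (b * f b x - 2 * c * (x * sin (b * x) * expR (- (c * x ^+ 2)))) = 0.
    rewrite /Rintegral (integral_derive_eq0 _ _ _ dF)//.
    - move=> x; apply/differentiable_continuous/derivable1_diffP.
      by rewrite /f; exact: ex_derive.
    - rewrite /comp; under eq_fun do rewrite EFinB.
      apply: (@integrableB _ _ R lebesgue_measure _ measurableT).
      + exact: (@integrableZl _ _ R lebesgue_measure _ measurableT b _ (intf b)).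
      + exact: (@integrableZl _ _ R lebesgue_measure _ measurableT _ _ (intxsin b)).
    - exact: F0.
    - by apply: F0 => n; rewrite sqrrN.
  rewrite RintegralB//=; last 2 first.
  - exact: (@integrableZl _ _ R lebesgue_measure _ measurableT b _ (intf b)).
  - exact: (@integrableZl _ _ R lebesgue_measure _ measurableT _ _ (intxsin b)).
  by rewrite subr_eq0 !RintegralZl// => /eqP.
have dphi b : is_derive b (1 : R) phi (- (b / (2 * c) * phi b)).
  have df (x y : R) : is_derive x (1 : R) (f^~ y)
      (- (y * sin (x * y) * expR (- (c * y ^+ 2)))).
    rewrite /f; apply: is_derive_eq; rewrite /GRing.scale/=; ring.
  have ub x y : `|partial1of2 f x y| <= `|y| * expR (- (c * y ^+ 2)).
    rewrite partial1of2E derive_val normrN !normrM (ger0_norm (expR_ge0 _)).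
    rewrite ler_wpM2r ?expR_ge0// ler_piMr// ler_norml.
    by rewrite sin_le1 sin_geN1.
  (* The bound [ub] is uniform in the parameter, so any open interval around [b] would serve. *)
  have bI : `]b - 1, b + 1[%classic b by rewrite /= in_itv/=; lra.
  have derf x y : derivable (f^~ y) x 1 by exact: ex_derive.
  have derphi := @derivable_under_integral R _ _ lebesgue_measure f setT
    measurableT b (b - 1) (b + 1) bI (fun x _ => intf x)
    (fun x y _ _ => derf x y) (fun y => `|y| * expR (- (c * y ^+ 2)))
    (fun y => mulr_ge0 (normr_ge0 y) (expR_ge0 _)) (integrable_mul_gauss _ _ c0)
    (fun x y _ _ => ub x y).
  have dphiE := @differentiation_under_integral R _ _ lebesgue_measure f setT
    measurableT b (b - 1) (b + 1) bI (fun x _ => intf x)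
    (fun x y _ _ => derf x y) (fun y => `|y| * expR (- (c * y ^+ 2)))
    (fun y => mulr_ge0 (normr_ge0 y) (expR_ge0 _)) (integrable_mul_gauss _ _ c0)
    (fun x y _ _ => ub x y).
  apply: DeriveDef; first exact: derphi.
  rewrite -derive1E dphiE.
  under eq_Rintegral => y _.
    rewrite partial1of2E derive_val -mulN1r; over.
  rewrite RintegralZl//=.
  rewrite mulrAC parts; field.
  by rewrite gt_eqF.
(* The integrating factor of the differential equation for [phi]; the product is constant, and its
   values at 0 and 1 are compared. *)
have dh b : is_derive b (1 : R) (fun b => phi b * expR (b ^+ 2 / (4 * c))) 0.
  apply: is_derive_eq; rewrite /GRing.scale/=; field.
  by rewrite gt_eqF.
have := is_derive_0_is_cst 1 0 dh.
rewrite /= expr0n/= expr1n mul0r expR0 mulr1 mul1r => h10.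
have phi0 : phi 0 = Num.sqrt (pi / c).
  rewrite /phi /f; under eq_Rintegral do rewrite mul0r cos0 mul1r.
  by rewrite /Rintegral integral_gauss.
have phi1 : phi 1 = \int[lebesgue_measure]_x (cos x * expR (- (c * x ^+ 2))).
  by rewrite /phi /f; under eq_Rintegral do rewrite mul1r.
by rewrite -phi1 -phi0 -h10 -mulrA -expRD subrr expR0 mulr1.
Unshelve. all: end_near. Qed.

Lemma integral_onem_cos_gauss (R : realType) (c : R) : 0 < c ->
  (\int[lebesgue_measure]_x ((1 - cos x) * expR (- (c * x ^+ 2)))%:E)%E =
  (Num.sqrt (pi / c) * (1 - expR (- (4 * c)^-1)))%:E.
Proof.
move=> c0.
have mg : measurable_fun [set: R] (fun x : R => expR (- (c * x ^+ 2))).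
  apply: measurableT_comp => //=.
  by apply: measurableT_comp => //=; exact: measurable_funM.
have intc : lebesgue_measure.-integrable [set: R]
    (fun x => (cos x * expR (- (c * x ^+ 2)))%:E).
  apply: (@le_integrable _ _ R lebesgue_measure _ measurableT _
    (fun x => (expR (- (c * x ^+ 2)))%:E)).
  - apply/measurable_EFinP; apply: measurable_funM => //.
    by apply: continuous_measurable_fun; exact: continuous_cos.
  - move=> x _ /=; rewrite lee_fin normrM ler_piMl// ler_norml.
    by rewrite cos_le1 cos_geN1.
  - exact: integrable_gauss.
under eq_integral do rewrite mulrBl mul1r EFinB.
rewrite integralB//=; last exact: integrable_gauss.
rewrite integral_gauss// mulrBr mulr1 EFinB -integral_cos_gauss//.
by rewrite /Rintegral fineK// integrable_fin_num.
Qed.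

(** * Gaussian integrals in several variables *)

(** Tonelli's theorem read through the image measure that defines [lebesgue_tuple]; this is the tool
    for induction on the dimension. *)
Lemma ge0_integral_lebesgue_tupleS (R : realType) (n : nat)
    (f : n.+1.-tuple R -> \bar R) :
  measurable_fun [set: n.+1.-tuple R] f -> (forall z, (0 <= f z)%E) ->
  (\int[lebesgue_tuple R n.+1]_z f z =
   \int[lebesgue_measure]_x \int[lebesgue_tuple R n]_z f (tuple_cons (x, z)))%E.
Proof.
move=> mf f0.
have mcons : measurable_fun [set: measurableTypeR R * n.-tuple R]
  (@tuple_cons R n) by exact: measurable_tuple_cons.
rewrite (_ : (\int[lebesgue_tuple R n.+1]_z f z)%E =
  \int[pushforward (@lebesgue_measure R \x lebesgue_tuple R n)%E
    (@tuple_cons R n)]_z f z)%E//.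
rewrite (ge0_integral_pushforward mcons)//.
rewrite preimage_setT fubini_tonelli1//=; exact: measurableT_comp.
Qed.

Definition sqnorm {R : realType} {n : nat} (z : n.-tuple R) : R :=
  \sum_(i < n) tnth z i ^+ 2.

Lemma sqnorm_cons (R : realType) (n : nat) (x : R) (z : n.-tuple R) :
  sqnorm (tuple_cons (x, z)) = x ^+ 2 + sqnorm z.
Proof.
rewrite /sqnorm big_ord_recl/= tnth0; congr (_ + _).
by apply: eq_bigr => i _; rewrite tnthS.
Qed.

Lemma measurable_sqnorm (R : realType) (n : nat) :
  measurable_fun [set: n.-tuple R] (@sqnorm R n).
Proof.
apply: measurable_sum => i; apply: measurable_funX.
exact: (@measurable_tnth _ (measurableTypeR R)).
Qed.

Lemma measurable_last (R : realType) (n : nat) :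
  measurable_fun [set: n.-tuple R] (fun z : n.-tuple R => last 0 z).
Proof.
case: n => [|n].
  by rewrite (_ : (fun _ => _) = cst 0)//; apply/funext => z; rewrite tuple0.
rewrite (_ : (fun _ => _) = (fun z => tnth z ord_max)).
  exact: (@measurable_tnth _ (measurableTypeR R)).
apply/funext => z.
by have := nth_last 0 z; rewrite (tnth_nth 0) size_tuple => <-.
Qed.

Lemma measurable_sqnorm_gauss (R : realType) (n : nat) (c : R) :
  measurable_fun [set: n.-tuple R] (fun z => expR (- (c * sqnorm z))).
Proof.
apply: measurableT_comp => //; apply: measurableT_comp => //.
by apply: measurable_funM => //; exact: measurable_sqnorm.
Qed.

(** The Gaussian factors over the coordinates, and each contributes the one-dimensional value. In
    dimension 0 the measure is a Dirac mass, which gives 1. *)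
Lemma integral_sqnorm_gauss (R : realType) (n : nat) (c : R) : 0 < c ->
  (\int[lebesgue_tuple R n]_z (expR (- (c * sqnorm z)))%:E)%E =
  (Num.sqrt (pi / c) ^+ n)%:E.
Proof.
move=> c0; elim: n => [|n IHn].
  rewrite /= integral_dirac//=; last first.
    by apply/measurable_EFinP; exact: measurable_sqnorm_gauss.
  by rewrite diracT mul1e /sqnorm big_ord0 mulr0 oppr0 expR0.
rewrite ge0_integral_lebesgue_tupleS; last 2 first.
- by apply/measurable_EFinP; exact: measurable_sqnorm_gauss.
- by move=> z; rewrite lee_fin expR_ge0.
under eq_integral => x _.
  under eq_integral do rewrite sqnorm_cons mulrDr opprD expRD EFinM.
  rewrite ge0_integralZl_EFin ?expR_ge0//; last first.
    by apply/measurable_EFinP; exact: measurable_sqnorm_gauss.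
  rewrite IHn muleC; over.
rewrite ge0_integralZl_EFin ?exprn_ge0//; last first.
  apply/measurable_EFinP; apply: measurableT_comp => //=.
  by apply: measurableT_comp => //=; exact: measurable_funM.
by rewrite integral_gauss// -EFinM exprSr.
Qed.

Lemma measurable_onem_cos_sqnorm_gauss (R : realType) (n : nat) (c : R) :
  measurable_fun [set: n.-tuple R]
    (fun z => (1 - cos (last 0 z)) * expR (- (c * sqnorm z))).
Proof.
apply: measurable_funM; last exact: measurable_sqnorm_gauss.
apply: measurable_funB => //; apply: measurableT_comp; last exact: measurable_last.
by apply: continuous_measurable_fun; exact: continuous_cos.
Qed.

Lemma onem_cos_ge0 (R : realType) (x : R) : 0 <= 1 - cos x.
Proof. by rewrite subr_ge0 cos_le1. Qed.

(** Slicing removes the first coordinate while the cosine sees the last one. The induction therefore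
    starts in dimension 1, where they coincide, and each further coordinate contributes only a
    Gaussian factor. *)
Lemma integral_onem_cos_sqnorm_gauss (R : realType) (n : nat) (c : R) : 0 < c ->
  (\int[lebesgue_tuple R n.+1]_z
    ((1 - cos (last 0 z)) * expR (- (c * sqnorm z)))%:E)%E =
  (Num.sqrt (pi / c) ^+ n.+1 * (1 - expR (- (4 * c)^-1)))%:E.
Proof.
move=> c0; elim: n => [|n IHn].
  rewrite ge0_integral_lebesgue_tupleS; last 2 first.
  - by apply/measurable_EFinP; exact: measurable_onem_cos_sqnorm_gauss.
  - by move=> z; rewrite lee_fin mulr_ge0 ?expR_ge0 ?onem_cos_ge0.
  rewrite expr1 -integral_onem_cos_gauss//; apply: eq_integral => x _.
  rewrite /= integral_dirac//=; last first.
    set f := (X in measurable_fun _ X).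
    by rewrite (_ : f = cst (f [tuple]))//; apply/funext => z; rewrite tuple0.
  by rewrite diracT mul1e sqnorm_cons /sqnorm big_ord0 addr0.
rewrite ge0_integral_lebesgue_tupleS; last 2 first.
- by apply/measurable_EFinP; exact: measurable_onem_cos_sqnorm_gauss.
- by move=> z; rewrite lee_fin mulr_ge0 ?expR_ge0 ?onem_cos_ge0.
under eq_integral => x _.
  under eq_integral => z _.
    rewrite sqnorm_cons mulrDr opprD expRD mulrCA EFinM.
    rewrite (_ : last 0 (tuple_cons (x, z)) = last 0 z); last first.
      by case: z => -[].
    over.
  rewrite ge0_integralZl_EFin ?expR_ge0//; last first.
    by apply/measurable_EFinP; exact: measurable_onem_cos_sqnorm_gauss.
  rewrite IHn muleC; over.
rewrite ge0_integralZl_EFin//; last 2 first.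
- apply/measurable_EFinP; apply: measurableT_comp => //=.
  by apply: measurableT_comp => //=; exact: measurable_funM.
- rewrite mulr_ge0 ?exprn_ge0// subr_ge0 -expR0 ler_expR oppr_le0.
  by rewrite invr_ge0 mulr_ge0// ltW.
by rewrite integral_gauss// -EFinM mulrAC -exprSr.
Qed.

(** * Inversion on the half-line and Euler's integral *)

(** Monotone convergence along compact intervals. The scale [k] is there because [w |-> k / w]
    carries the intervals of scale 1 onto those of scale [k]. *)
Lemma cvg_integral_0y (R : realType) (k : R) (f : R -> \bar R) : 0 < k ->
  measurable_fun (`]0, +oo[ : set R) f -> (forall x, 0 < x -> (0 <= f x)%E) ->
  (\int[lebesgue_measure]_(x in `[(k * n.+1%:R^-1)%R, (k * n.+1%:R)%R]) f x)%E
    @[n --> \oo] --> (\int[lebesgue_measure]_(x in `]0%R, +oo[) f x)%E.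
Proof.
move=> k0 mf f0.
have I0 n x : `[k * n.+1%:R^-1, k * n.+1%:R]%classic x -> 0 < x.
  rewrite /= in_itv/= => /andP[+ _]; apply: lt_le_trans.
  by rewrite mulr_gt0.
rewrite (_ : `]0, +oo[%classic =
    \bigcup_n `[k * n.+1%:R^-1, k * n.+1%:R]%classic); last first.
  apply/seteqP; split => [x|x [n _ /I0]]; rewrite /= in_itv/= andbT// => x0.
  near \oo => n; exists n => //=; rewrite in_itv/=; apply/andP; split.
  - rewrite ler_pdivrMr// mulrC -ler_pdivrMr//.
    rewrite (@le_trans _ _ n%:R) ?ler_nat//.
    by near: n; exact: nbhs_infty_ger.
  - rewrite mulrC -ler_pdivrMr//.
    rewrite (@le_trans _ _ n%:R) ?ler_nat//.
    by near: n; exact: nbhs_infty_ger.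
apply: ge0_nondecreasing_set_cvg_integral.
- apply/nondecreasing_seqP => n; rewrite subsetEset.
  apply: subset_itvScc; rewrite bnd_simp ler_pM2l//.
    by rewrite lef_pV2 ?posrE// ler_nat.
  by rewrite ler_nat.
- by move=> n; exact: measurable_itv.
- move=> n; apply: measurable_funS mf => // x /I0 x0.
  by rewrite /= in_itv/= x0.
- by move=> n x /I0; exact: f0.
Unshelve. all: end_near. Qed.

(** The substitution [t = k / w] is made on compact intervals; both sides are then limits of the
    same sequence in [\bar R]. *)
Lemma integral_0y_inv (R : realType) (k : R) (G : R -> R) : 0 < k ->
  {in `]0, +oo[, continuous G} -> (forall x, 0 < x -> 0 <= G x) ->
  (\int[lebesgue_measure]_(t in `]0%R, +oo[) (G t)%:E =
   \int[lebesgue_measure]_(w in `]0%R, +oo[) (G (k / w) * (k / w ^+ 2))%:E)%E.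
Proof.
move=> k0 cG G0.
pose F w : R := k / w.
have F0 w : 0 < w -> 0 < F w by move=> w0; rewrite divr_gt0.
have dF (w : R) : 0 < w -> is_derive w (1 : R) F (- (k / w ^+ 2)).
  move=> w0; rewrite /F.
  have w1 : w != 0 by rewrite gt_eqF.
  have dV := is_deriveV w1 (is_derive_id w (1 : R)).
  by apply: is_derive_eq; rewrite /GRing.scale/= mulr1 mulrN.
have F'E (w : R) : 0 < w -> F^`()%classic w = - (k / w ^+ 2).
  by move=> /dF ?; rewrite derive1E derive_val.
have cF (w : R) : 0 < w -> {for w, continuous F}.
  by move=> /dF ?; apply/differentiable_continuous/derivable1_diffP.
have ck2 (w : R) : 0 < w -> {for w, continuous (fun w : R => k / w ^+ 2)}.
  move=> w0; apply: cvgM; first exact: cvg_cst.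
  by apply: cvgV; [rewrite expf_neq0// gt_eqF|exact: exprn_continuous].
have cF' (w : R) : 0 < w -> {for w, continuous F^`()%classic}.
  move=> w0; rewrite /prop_for/continuous_at F'E//.
  apply: (@cvg_trans _ (- (k / x ^+ 2) @[x --> w])).
    apply: near_eq_cvg; near=> x; rewrite F'E//.
    by near: x; exact: lt_nbhsr.
  exact: (cvgN (ck2 _ w0)).
have step n :
    (\int[lebesgue_measure]_(t in `[(k * n.+1%:R^-1)%R, (k * n.+1%:R)%R])
       (G t)%:E =
     \int[lebesgue_measure]_(w in `[(1 * n.+1%:R^-1)%R, (1 * n.+1%:R)%R])
       (G (k / w) * (k / w ^+ 2))%:E)%E.
  have n0 : (0 : R) < n.+1%:R^-1 by [].
  have n1 : (0 : R) < n.+1%:R by [].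
  (* As [F] is decreasing, the endpoints are exchanged. *)
  have E1 : k * n.+1%:R^-1 = F n.+1%:R by [].
  have E2 : k * n.+1%:R = F (n.+1%:R^-1) by rewrite /F invrK.
  rewrite !mul1r E1 E2 integration_by_substitution_decreasing//.
  - apply: eq_integral => x; rewrite inE/= in_itv/= => /andP[x0 _].
    have {}x0 := lt_le_trans n0 x0.
    by rewrite !fctE F'E// opprK.
  - by rewrite (@le_trans _ _ 1)// ?invf_le1// ler1n.
  - move=> x y; rewrite !in_itv/= => /andP[x0 _] /andP[y0 _] xy.
    rewrite /F ltr_pM2l// ltf_pV2// posrE; exact: lt_le_trans n0 _.
  - by move=> x; rewrite in_itv/= => /andP[x0 _]; apply: cF'; exact: lt_trans n0 _.
  - by apply/cvg_ex; eexists; apply/cvg_at_right_filter/cF'.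
  - by apply/cvg_ex; eexists; apply/cvg_at_left_filter/cF'.
  - split.
    + by move=> x; rewrite in_itv/= => /andP[x0 _]; have ? := dF _ (lt_trans n0 x0).
    + by apply/cvg_at_right_filter/cF.
    + by apply/cvg_at_left_filter/cF.
  - apply: continuous_in_subspaceT => x; rewrite inE/= in_itv/= => /andP[x0 _].
    by apply: cG; rewrite in_itv/= andbT (lt_le_trans _ x0)// F0.
have GF0 x : 0 < x -> 0 <= G (k / x) * (k / x ^+ 2).
  by move=> x0; rewrite mulr_ge0 ?G0 ?F0// divr_ge0 ?sqr_ge0// ltW.
have mG : measurable_fun (`]0, +oo[ : set R) (EFin \o G).
  apply/measurable_EFinP; apply: open_continuous_measurable_fun => //.
  by move=> x; rewrite inE/=; exact: cG.
have mGF : measurable_fun (`]0, +oo[ : set R)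
    (fun w => (G (k / w) * (k / w ^+ 2))%:E).
  apply/measurable_EFinP; apply: open_continuous_measurable_fun => //.
  move=> x; rewrite inE/= in_itv/= andbT => x0.
  apply: cvgM; last exact: ck2.
  apply: (@continuous_comp _ _ _ F G); first exact: cF.
  by apply: cG; rewrite in_itv/= andbT F0.
have := cvg_integral_0y R k (fun t => (G t)%:E) k0 mG G0.
under eq_fun do rewrite step.
move=> lim1.
apply: (cvg_unique (@ereal_hausdorff R) lim1).
exact: (cvg_integral_0y R 1 (fun w => (G (k / w) * (k / w ^+ 2))%:E)).
Unshelve. all: end_near. Qed.

(* Euler's integral with values in [\bar R]: unlike [Gamma], whose junk value is 0
   when the integral diverges, it can be used before convergence is known. *)
Definition eGamma (R : realType) (a : R) : \bar R :=
  (\int[lebesgue_measure]_(t in `]0%R, +oo[) (t `^ (a - 1) * expR (- t))%:E)%E.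

Lemma powR_continuous (R : realType) (p x : R) : 0 < x ->
  {for x, continuous (fun w : R => w `^ p)}.
Proof.
move=> x0; apply/differentiable_continuous/derivable1_diffP.
by apply: derivable_powR; rewrite in_itv/= x0.
Qed.

(** The substitution [t = k / w]. The choice [k = |z|^2 / 4] produces a Gaussian in [z], and [k = 1]
    serves to prove convergence. *)
Lemma eGamma_inv (R : realType) (a k : R) : 0 < k ->
  eGamma R a = (\int[lebesgue_measure]_(w in `]0%R, +oo[)
    (k `^ a * (w `^ (- a - 1) * expR (- (k / w))))%:E)%E.
Proof.
move=> k0; rewrite /eGamma.
rewrite (integral_0y_inv R k (fun t => t `^ (a - 1) * expR (- t)))//.
- apply: eq_integral => w; rewrite inE/= in_itv/= andbT => w0; congr EFin.
  have w1 : w != 0 by rewrite gt_eqF.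
  have kw0 : 0 < k / w by rewrite divr_gt0.
  transitivity ((k / w) `^ (a - 1) * (k / w) * w^-1 * expR (- (k / w))).
    by field.
  rewrite [RHS]mulrA; congr (_ * _).
  have -> : (k / w) `^ (a - 1) * (k / w) = (k / w) `^ a.
    have := @powRD _ (k / w) (a - 1) 1.
    by rewrite subrK (powRr1 (ltW kw0)) (gt_eqF kw0) implybT => ->.
  rewrite powRM ?invr_ge0 ?ltW// -mulrA; congr (_ * _).
  rewrite powRB ?w1 ?implybT// powRr1 ?ltW//; congr (_ * _).
  by rewrite -powR_inv1 ?ltW// -powRrM mulN1r.
- move=> x; rewrite in_itv/= andbT => x0; apply: cvgM; first exact: powR_continuous.
  by apply: continuous_comp; [exact: opp_continuous|exact: continuous_expR].
- by move=> x x0; rewrite mulr_ge0 ?powR_ge0 ?expR_ge0.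
Qed.

(** * The remaining integral in [w] *)

Lemma integral_0w_expRN (R : realType) (w : R) : 0 < w ->
  (\int[lebesgue_measure]_(v in `]0%R, w[) (expR (- v))%:E)%E =
  (1 - expR (- w))%:E.
Proof.
move=> w0.
have cE : continuous (fun v : R => expR (- v)).
  move=> x; apply: continuous_comp; first exact: opp_continuous.
  exact: continuous_expR.
rewrite -(@integral_itv_bndoo _ _ _ _ true false); last first.
  by apply/measurable_EFinP/measurable_funTS; exact: continuous_measurable_fun.
rewrite (@continuous_FTC2 _ _ (fun v => - expR (- v)))//.
- by rewrite oppr0 expR0 -EFinB; congr EFin; rewrite opprK addrC.
- exact: continuous_subspaceT.
- split => //.
  + by apply/cvg_at_right_filter; apply: cvgN; exact: cE.
  + by apply/cvg_at_left_filter; apply: cvgN; exact: cE.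
- move=> x _; rewrite derive1E derive_val /GRing.scale/=; ring.
Qed.

Lemma cvg_powRN (R : realType) (s : R) : 0 < s -> x `^ (- s) @[x --> +oo] --> 0.
Proof.
move=> s0; apply/cvgrPdist_le => e e0; near=> x.
rewrite sub0r normrN ger0_norm ?powR_ge0// powRN.
have x0 : 0 < x by near: x; exact: nbhs_pinfty_gt.
rewrite invf_ple ?posrE ?powR_gt0//.
(* With [e^-1] written as [((e^-1)^(1/s))^s], it is enough that [x] exceed [(e^-1)^(1/s)]. *)
rewrite -[leLHS]powRr1 ?invr_ge0 ?(ltW e0)// -(@mulVf _ s) ?gt_eqF//.
rewrite powRrM.
apply: ge0_ler_powR; rewrite ?nnegrE ?powR_ge0 ?(ltW x0) ?(ltW s0)//.
Unshelve. all: end_near. Qed.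

Lemma integral_powRNy (R : realType) (s v : R) : 0 < s -> 0 < v ->
  (\int[lebesgue_measure]_(w in `[v, +oo[) (w `^ (- s - 1))%:E)%E =
  (v `^ (- s) / s)%:E.
Proof.
move=> s0 v0.
have dF (x : R) : 0 < x ->
    is_derive x (1 : R) (fun w : R => - (w `^ (- s) / s)) (x `^ (- s - 1)).
  move=> x0.
  have dp : is_derive x (1 : R) (fun w : R => w `^ (- s)) (- s * x `^ (- s - 1)).
    apply: DeriveDef; first by apply: derivable_powR; rewrite in_itv/= x0.
    by rewrite -derive1E powR_derive1// in_itv/= x0.
  apply: is_derive_eq; rewrite /GRing.scale/=; field.
  by rewrite gt_eqF.
rewrite (@ge0_continuous_FTC2y _ _ (fun w => - (w `^ (- s) / s)) _ 0)//.
- by rewrite sub0e -EFinN opprK.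
- by move=> x vx; exact: powR_ge0.
- apply: continuous_in_subspaceT => x; rewrite inE/= in_itv/= andbT => vx.
  by apply: powR_continuous; exact: lt_le_trans vx.
- rewrite -oppr0 -(mul0r s^-1).
  apply: cvgN; apply: cvgM; last exact: cvg_cst.
  exact: cvg_powRN.
- move=> x vx; have ? := dF _ (lt_trans v0 vx); exact: ex_derive.
- apply: cvg_at_right_filter; have ? := dF _ v0.
  have cF : {for v, continuous (fun w : R => - (w `^ (- s) / s))}.
    by apply/differentiable_continuous/derivable1_diffP.
  exact: cF.
- move=> x; rewrite in_itv/= andbT => vx; have ? := dF _ (lt_trans v0 vx).
  by rewrite derive1E derive_val.
Qed.

Lemma measurable_0lt_lt (R : realType) :
  measurable [set p : measurableTypeR R * measurableTypeR R | 0 < p.1 < p.2].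
Proof.
rewrite (_ : [set _ | _] =
  (fun p : measurableTypeR R * measurableTypeR R => (0 < p.1) && (p.1 < p.2))
    @^-1` [set true]); last first.
  by apply/seteqP; split => p /=.
rewrite -[X in measurable X]setTI.
apply: measurable_and => //.
- by apply: measurable_fun_ltr => //; exact: measurable_fst.
- by apply: measurable_fun_ltr; [exact: measurable_fst|exact: measurable_snd].
Qed.

(** Both sides are iterated integrals of [w^(-s-1) exp(-v)] over [0 < v < w]. Integrating first in
    [w] leaves [v^(-s) exp(-v) / s], and [-s = (1 - s) - 1] is the exponent in Euler's integral at
    [1 - s]. *)
Lemma integral_powRN_onem_expRN (R : realType) (s : R) : 0 < s ->
  (\int[lebesgue_measure]_(w in `]0%R, +oo[)
     (w `^ (- s - 1) * (1 - expR (- w)))%:E)%E =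
  (s^-1%:E * eGamma R (1 - s))%E.
Proof.
move=> s0.
pose A := [set p : measurableTypeR R * measurableTypeR R | 0 < p.1 < p.2].
pose f := (fun p : measurableTypeR R * measurableTypeR R =>
  (p.2 `^ (- s - 1) * expR (- p.1))%:E) \_ A.
have meN : measurable_fun [set: R] (fun v : R => expR (- v)).
  by apply: measurableT_comp.
have mf : measurable_fun setT f.
  apply/(measurable_restrictT _ _).1; first exact: measurable_0lt_lt.
  apply/measurable_funTS/measurable_EFinP/measurable_funM.
  - apply: (@measurableT_comp _ _ _ _ (measurableTypeR R) _
      (fun w => w `^ (- s - 1))).
      exact: measurable_powR.
    exact: measurable_snd.
  - apply: (@measurableT_comp _ _ _ _ (measurableTypeR R) _ (fun v => expR (- v))).
      exact: meN.
    exact: measurable_fst.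
have f0 p : (0 <= f p)%E.
  rewrite /f patchE; case: ifP => // _.
  by rewrite lee_fin mulr_ge0 ?powR_ge0 ?expR_ge0.
have := fubini_tonelli
  (m1 := @lebesgue_measure R) (m2 := @lebesgue_measure R) f mf f0.
have inner2 v : (\int[lebesgue_measure]_w f (v, w))%E =
   ((fun v : R => (s^-1%:E * (v `^ (1 - s - 1) * expR (- v))%:E)%E)
     \_ `]0%R, +oo[) v.
  rewrite patchE; case: ifPn => [|v0].
    rewrite inE/= in_itv/= andbT => v0.
    rewrite -[RHS]muleC -EFinM.
    rewrite (_ : 1 - s - 1 = - s); last by ring.
    rewrite mulrAC EFinM -integral_powRNy// muleC.
    (* The inequality [v < w] in [A] is strict, so the null endpoint [v] is dropped. *)
    rewrite -integral_itv_obnd_cbnd; last first.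
      by apply/measurable_EFinP/measurable_funTS; exact: measurable_powR.
    rewrite -ge0_integralZl_EFin ?expR_ge0//; last 2 first.
    - by move=> w _; rewrite lee_fin powR_ge0.
    - by apply/measurable_EFinP/measurable_funTS; exact: measurable_powR.
    rewrite [RHS]integral_mkcond; apply: eq_integral => w _.
    rewrite /f !patchE; congr (if _ then _ else _); last by rewrite mulrC EFinM.
    by apply/idP/idP; rewrite !inE/= /A/= in_itv/= v0 andbT.
  rewrite integral0_eq// => w _; rewrite /f patchE ifF//.
  apply/negP; rewrite inE/= => /andP[v1 _]; move/negP : v0; apply.
  by rewrite inE/= in_itv/= v1.
have inner1 w : (\int[lebesgue_measure]_v f (v, w))%E =
   ((fun w : R => (w `^ (- s - 1) * (1 - expR (- w)))%:E) \_ `]0%R, +oo[) w.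
  rewrite patchE; case: ifPn => [|w0].
    rewrite inE/= in_itv/= andbT => w0.
    rewrite EFinM -integral_0w_expRN//.
    rewrite -ge0_integralZl_EFin ?powR_ge0//; last first.
      by apply/measurable_EFinP/measurable_funTS.
    rewrite [RHS]integral_mkcond; apply: eq_integral => v _.
    rewrite /f !patchE; congr (if _ then _ else _).
  rewrite integral0_eq// => v _; rewrite /f patchE ifF//.
  apply/negP; rewrite inE/= => /andP[v1 /(lt_trans v1) v2]; move/negP : w0; apply.
  by rewrite inE/= in_itv/= v2.
under eq_integral do rewrite inner2.
under [X in _ = X -> _]eq_integral do rewrite inner1.
rewrite -!integral_mkcond => <-.
rewrite ge0_integralZl_EFin// ?invr_ge0 ?ltW//.
- by move=> x _; rewrite lee_fin mulr_ge0 ?powR_ge0 ?expR_ge0.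
- by apply/measurable_EFinP/measurable_funTS/measurable_funM.
Qed.

(** * Positivity and convergence of Euler's integral *)

(** If the integral were zero, the integrand would vanish almost everywhere, yet it is positive on a
    half-line of infinite measure. *)
Lemma eGamma_gt0 (R : realType) (a : R) : (0 < eGamma R a)%E.
Proof.
rewrite lt0e; apply/andP; split; last first.
  by apply: integral_ge0 => t _; rewrite lee_fin mulr_ge0 ?powR_ge0 ?expR_ge0.
apply/eqP => /= G0.
have mG : measurable_fun (`]0, +oo[ : set R)
    (fun t => (t `^ (a - 1) * expR (- t))%:E).
  apply/measurable_EFinP/measurable_funTS/measurable_funM => //.
  exact: measurableT_comp.
have : (\int[lebesgue_measure]_(t in `]0%R, +oo[)
    `|(t `^ (a - 1) * expR (- t))%:E| = 0)%E.
  rewrite -[RHS]G0; apply: eq_integral => t _.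
  by rewrite gee0_abs// lee_fin mulr_ge0 ?powR_ge0 ?expR_ge0.
move=> /(ae_eq_integral_abs lebesgue_measure (measurable_itv _) mG).1.
move=> [N [mN N0 subN]].
have : (@lebesgue_measure R `]0%R, +oo[ <= lebesgue_measure N)%E.
  apply: le_measure; rewrite ?inE//.
  move=> t t0; apply: subN => /= /(_ t0)[] /eqP.
  move: t0; rewrite /= in_itv/= andbT => t0.
  by rewrite gt_eqF// mulr_gt0 ?powR_gt0 ?expR_gt0.
by rewrite N0 lebesgue_measure_itv/= ltry.
Qed.

(* After [t = 1/w] the singularity at 0 moves to infinity: the integrand is at
   most 4 for [w < 1], and at most [w^(s-2)] for [w >= 1]. *)
Lemma eGamma_onem_lty (R : realType) (s : R) : 0 < s < 1 ->
  (eGamma R (1 - s) < +oo)%E.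
Proof.
move=> /andP[s0 s1]; rewrite (eGamma_inv R _ 1)//.
set g := (X in (integral _ _ X < _)%E).
have mg : measurable_fun (`]0, +oo[ : set R) g.
  apply/measurable_EFinP/measurable_funM => //; apply: measurable_funM.
    by apply: measurable_funTS; exact: measurable_powR.
  apply: open_continuous_measurable_fun => // w.
  rewrite inE/= in_itv/= andbT => w0.
  apply: continuous_comp; last exact: continuous_expR.
  apply: (@cvgN _ R^o); apply: cvgM; first exact: cvg_cst.
  by apply: inv_continuous; rewrite gt_eqF.
have g0 w : (0 <= g w)%E by rewrite /g lee_fin !mulr_ge0 ?powR_ge0 ?expR_ge0.
rewrite (@itv_bndbnd_setU _ _ (BRight 0) (BLeft 1) +oo%O) ?bnd_simp//.
rewrite ge0_integral_setU//=; last 3 first.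
- by rewrite -itv_bndbnd_setU ?bnd_simp.
- by move=> w _; exact: g0.
- apply/disj_setPS => w []; rewrite /= !in_itv/= andbT => /andP[_ w1].
  by rewrite leNgt w1.
apply: lte_add_pinfty.
- apply: (@le_lt_trans _ _ (\int[lebesgue_measure]_(w in `]0%R, 1%R[) 4%:E)%E).
    apply: ge0_le_integral => //=.
    + by move=> w _; exact: g0.
    + by apply: (measurable_funS _ _ mg) => //; exact: subset_itvl.
    + move=> w; rewrite in_itv/= => /andP[w0 w1].
      rewrite powR1 mul1r lee_fin.
      have V0 : 0 < w^-1 by rewrite invr_gt0.
      (* Squaring [exp(x/2) >= x/2] at [x = 1/w]; inverted, this reads [exp(-1/w) <= 4 w^2], which
         compensates [w^(-2)] and leaves the constant 4. *)
      have eV : (w^-1 / 2) ^+ 2 <= expR w^-1.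
        rewrite (_ : w^-1 = w^-1 / 2 + w^-1 / 2); last by field; rewrite gt_eqF.
        rewrite expRD -expr2 -splitr.
        rewrite ler_pXn2r ?nnegrE ?expR_ge0 ?divr_ge0 ?(ltW V0)//.
        by rewrite (le_trans _ (expR_ge1Dx _))// lerDr.
      apply: (@le_trans _ _ (w `^ (- 2) * (4 * w ^+ 2))).
        rewrite ler_pM ?powR_ge0 ?expR_ge0//.
          by apply: ger_powR; rewrite ?w0//; lra.
        rewrite mul1r expRN -[leRHS]invrK lef_pV2 ?posrE ?expR_gt0//; last first.
          by rewrite invr_gt0 mulr_gt0 ?exprn_gt0.
        rewrite (_ : (4 * w ^+ 2)^-1 = (w^-1 / 2) ^+ 2)//; field.
        by rewrite gt_eqF.
      rewrite (powR_invn 2 (ltW w0)) mulrCA mulVf ?mulr1//.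
      by rewrite expf_neq0// gt_eqF.
  by rewrite integral_cst//= lebesgue_measure_itv/= lte01 -EFinB -EFinM ltry.
- apply: (@le_lt_trans _ _ (\int[lebesgue_measure]_(w in `[1%R, +oo[)
      (w `^ (- (1 - s) - 1))%:E)%E).
    apply: ge0_le_integral => //=.
    + by move=> w _; exact: g0.
    + apply: (measurable_funS _ _ mg) => //; apply: subset_itvr.
      by rewrite bnd_simp.
    + by apply/measurable_EFinP/measurable_funTS; exact: measurable_powR.
    + move=> w; rewrite in_itv/= andbT => w1.
      rewrite powR1 mul1r lee_fin ler_piMr ?powR_ge0// -expR0 ler_expR.
      by rewrite oppr_le0 divr_ge0// (le_trans _ w1).
  by rewrite integral_powRNy ?subr_gt0// ltry.
Qed.

(** * Subordination to Gaussians and the value of the constant *)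

Lemma sqnorm_ge0 (R : realType) (n : nat) (z : n.-tuple R) : 0 <= sqnorm z.
Proof. by apply: sumr_ge0 => i _; exact: sqr_ge0. Qed.

Lemma euclidean_norm_powR (R : realType) (n : nat) (z : n.-tuple R) (p : R) :
  euclidean_norm z `^ p = sqnorm z `^ (p / 2).
Proof.
rewrite /euclidean_norm -/(sqnorm z) -powR12_sqrt ?sqnorm_ge0//.
by rewrite -powRrM mulrC.
Qed.

(** Used at the origin, where the numerator [1 - cos] is then 0 and the quotient is 0 whatever its
    denominator. *)
Lemma sqnorm_eq0_last (R : realType) (n : nat) (z : n.-tuple R) :
  sqnorm z = 0 -> last 0 z = 0.
Proof.
case: n z => [|n] z; first by rewrite tuple0.
move=> /eqP; rewrite psumr_eq0 => [/allP/(_ ord_max)|i _]; last exact: sqr_ge0.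
rewrite mem_index_enum => /(_ isT)/=; rewrite sqrf_eq0 => /eqP.
by have := nth_last 0 z; rewrite (tnth_nth 0) size_tuple => <-.
Qed.

Lemma measurable_onem_cos_div_norm (R : realType) (n : nat) (p : R) :
  measurable_fun [set: n.-tuple R]
    (fun z => (1 - cos (last 0 z)) / euclidean_norm z `^ p).
Proof.
under eq_fun do rewrite euclidean_norm_powR -powRN.
apply: measurable_funM.
  apply: measurable_funB => //; apply: measurableT_comp; last exact: measurable_last.
  by apply: continuous_measurable_fun; exact: continuous_cos.
apply: (@measurableT_comp _ _ _ _ _ _ (fun x => x `^ (- (p / 2)))).
  exact: measurable_powR.
exact: measurable_sqnorm.
Qed.

(** Away from the origin this is [eGamma_inv] with [k = |z|^2 / 4]: the factor [k^(p/2)] cancels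
    [|z|^p] and leaves [4^(-p/2)]. At the origin both sides vanish. *)
Lemma heat_kernel_subordination (R : realType) (n : nat) (p : R)
    (z : n.-tuple R) :
  (eGamma R (p / 2) * ((1 - cos (last 0 z)) / euclidean_norm z `^ p)%:E =
  \int[lebesgue_measure]_(w in `]0%R, +oo[)
    (4 `^ (- (p / 2)) * w `^ (- (p / 2) - 1) *
      ((1 - cos (last 0 z)) * expR (- ((4 * w)^-1 * sqnorm z))))%:E)%E.
Proof.
have [z0|zN0] := eqVneq (sqnorm z) 0.
  rewrite sqnorm_eq0_last// cos0 subrr mul0r mule0 integral0_eq// => w _.
  by rewrite mul0r mulr0.
have S0 : 0 < sqnorm z by rewrite lt0r zN0 sqnorm_ge0.
have mg : measurable_fun (`]0, +oo[ : set R) (fun w : R =>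
    (sqnorm z / 4) `^ (p / 2) *
      (w `^ (- (p / 2) - 1) * expR (- (sqnorm z / 4 / w)))).
  apply: measurable_funM => //; apply: measurable_funM.
    by apply: measurable_funTS; exact: measurable_powR.
  apply: open_continuous_measurable_fun => // w.
  rewrite inE/= in_itv/= andbT => w0.
  apply: continuous_comp; last exact: continuous_expR.
  apply: (@cvgN _ R^o); apply: cvgM; first exact: cvg_cst.
  by apply: inv_continuous; rewrite gt_eqF.
rewrite (eGamma_inv R _ (sqnorm z / 4)) ?divr_gt0// muleC.
rewrite -ge0_integralZl_EFin//; last 3 first.
- by move=> w _; rewrite lee_fin !mulr_ge0 ?powR_ge0 ?expR_ge0.
- exact/measurable_EFinP.
- by rewrite divr_ge0 ?powR_ge0// onem_cos_ge0.
apply: eq_integral => w; rewrite inE/= in_itv/= andbT => w0.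
rewrite -EFinM euclidean_norm_powR; congr EFin.
have -> : (sqnorm z / 4) `^ (p / 2) = sqnorm z `^ (p / 2) * 4 `^ (- (p / 2)).
  by rewrite powRM ?(ltW S0)// -(@powR_inv1 _ 4)// -powRrM mulN1r.
rewrite (_ : sqnorm z / 4 / w = (4 * w)^-1 * sqnorm z); last first.
  by field; rewrite gt_eqF.
by field; rewrite gt_eqF// powR_gt0.
Qed.

(** Stated in [\bar R], so that Tonelli applies before either factor on the left is known to be
    finite. *)
Lemma eGamma_mul_integral (R : realType) (n : nat) (s : R) : 0 < s ->
  (eGamma R ((n.+1%:R + 2 * s) / 2) * \int[lebesgue_tuple R n.+1]_z
     ((1 - cos (last 0 z)) / euclidean_norm z `^ (n.+1%:R + 2 * s))%:E =
  (pi `^ (n.+1%:R / 2) / (s * 2 `^ (2 * s)))%:E * eGamma R (1 - s))%E.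
Proof.
move=> s0; set p := n.+1%:R + 2 * s.
rewrite -ge0_integralZl//; last 3 first.
- by apply/measurable_EFinP; exact: measurable_onem_cos_div_norm.
- by move=> z _; rewrite lee_fin divr_ge0 ?powR_ge0// onem_cos_ge0.
- by rewrite ltW// eGamma_gt0.
under eq_integral do rewrite heat_kernel_subordination.
pose A := [set q : n.+1.-tuple R * measurableTypeR R | 0 < q.2].
(* The inverse of [w] is written as a power so that [mpow] gives its measurability; the two agree
   for [w > 0]. *)
pose f := (fun q : n.+1.-tuple R * measurableTypeR R =>
  (4 `^ (- (p / 2)) * q.2 `^ (- (p / 2) - 1) *
    ((1 - cos (last 0 q.1)) *
      expR (- ((4^-1 * q.2 `^ (-1)) * sqnorm q.1))))%:E) \_ A.
have mA : measurable A.
  rewrite (_ : A = (fun q => q.2) @^-1` [set` `]0%R, +oo[]); last first.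
    by apply/seteqP; split => q; rewrite /A/= in_itv/= andbT.
  by rewrite -[X in measurable X]setTI; exact: measurable_snd.
have mpow r : measurable_fun [set: n.+1.-tuple R * measurableTypeR R]
    (fun q => q.2 `^ r).
  apply: (@measurableT_comp _ _ _ _ (measurableTypeR R) _ (fun w => w `^ r)).
    exact: measurable_powR.
  exact: measurable_snd.
have mf : measurable_fun setT f.
  apply/(measurable_restrictT _ _).1 => //.
  apply/measurable_funTS/measurable_EFinP/measurable_funM.
    by apply: measurable_funM.
  apply: measurable_funM.
    apply: measurable_funB => //; apply: measurableT_comp.
      by apply: continuous_measurable_fun; exact: continuous_cos.
    exact: measurableT_comp (measurable_last _ _) measurable_fst.
  apply: measurableT_comp => //; apply: measurableT_comp => //.
  apply: measurable_funM; first by apply: measurable_funM.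
  exact: measurableT_comp (measurable_sqnorm _ _) measurable_fst.
have f0 q : (0 <= f q)%E.
  rewrite /f patchE; case: ifP => // _.
  by rewrite lee_fin !mulr_ge0 ?powR_ge0 ?expR_ge0 ?onem_cos_ge0.
transitivity (\int[lebesgue_tuple R n.+1]_z \int[lebesgue_measure]_w f (z, w))%E.
  apply: eq_integral => z _; rewrite integral_mkcond; apply: eq_integral => w _.
  rewrite /f !patchE (_ : (_ \in A) = (w \in `]0%R, +oo[%classic)); last first.
    by apply/idP/idP; rewrite !inE /A/= in_itv/= andbT.
  case: ifPn => //; rewrite inE/= in_itv/= andbT => w0.
  by rewrite powR_inv1 ?(ltW w0)// invfM.
rewrite (fubini_tonelli
  (m1 := lebesgue_tuple R n.+1) (m2 := @lebesgue_measure R) f)//.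
(* The Gaussian with [c = 1/(4w)] contributes [(4 pi w)^((n+1)/2)]; its power of [w] combines with
   [w^(-p/2-1)] into [w^(-s-1)]. *)
pose C := 4 `^ (- (p / 2)) * (4 * pi) `^ (n.+1%:R / 2).
transitivity (\int[lebesgue_measure]_(w in `]0%R, +oo[)
    (C%:E * (w `^ (- s - 1) * (1 - expR (- w)))%:E))%E.
  rewrite [RHS]integral_mkcond; apply: eq_integral => w _.
  rewrite patchE; case: ifPn => [|w0]; last first.
    rewrite integral0_eq// => z _; rewrite /f patchE ifF//.
    apply: contraNF w0; rewrite !inE/= in_itv/= andbT.
    exact.
  rewrite inE/= in_itv/= andbT => w0.
  have w1 : w != 0 by rewrite gt_eqF.
  have c0 : 0 < 4^-1 * w^-1 by rewrite mulr_gt0 ?invr_gt0.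
  transitivity (\int[lebesgue_tuple R n.+1]_z
      ((4 `^ (- (p / 2)) * w `^ (- (p / 2) - 1))%:E *
       ((1 - cos (last 0 z)) * expR (- (4^-1 * w^-1 * sqnorm z)))%:E))%E.
    apply: eq_integral => z _; rewrite /f patchE ifT ?inE//=.
    by rewrite powR_inv1 ?(ltW w0)// EFinM.
  rewrite ge0_integralZl_EFin ?mulr_ge0 ?powR_ge0//; last first.
    by apply/measurable_EFinP; exact: measurable_onem_cos_sqnorm_gauss.
  rewrite integral_onem_cos_sqnorm_gauss// -!EFinM; congr EFin.
  rewrite (_ : (4 * (4^-1 * w^-1))^-1 = w); last by field.
  rewrite !mulrA; congr (_ * _).
  rewrite (_ : pi / (4^-1 * w^-1) = 4 * pi * w); last by field.
  rewrite -powR12_sqrt ?mulr_ge0 ?pi_ge0 ?(ltW w0)// -powR_mulrn ?powR_ge0//.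
  rewrite -powRrM powRM ?mulr_ge0 ?pi_ge0 ?(ltW w0)// [2^-1 * _]mulrC.
  rewrite mulrACA -/C; congr (_ * _).
  rewrite -powRD ?w1 ?implybT//; congr (_ `^ _).
  by rewrite /p; field.
rewrite ge0_integralZl_EFin ?mulr_ge0 ?powR_ge0//; last 2 first.
- move=> w; rewrite /= in_itv/= andbT => w0; rewrite lee_fin mulr_ge0 ?powR_ge0//.
  by rewrite subr_ge0 -expR0 ler_expR oppr_le0 ltW.
- apply/measurable_EFinP/measurable_funTS/measurable_funM.
    exact: measurable_powR.
  by apply: measurable_funB => //; exact: measurableT_comp.
rewrite integral_powRN_onem_expRN// muleA -EFinM; congr (_%:E * _)%E.
rewrite /C powRM ?pi_ge0// mulrA -powRD ?implybT//; last first.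
  by rewrite pnatr_eq0 implybT.
rewrite (_ : - (p / 2) + n.+1%:R / 2 = - s); last by rewrite /p; field.
rewrite powRN (_ : 4 `^ s = 2 `^ (2 * s)); last first.
  rewrite (_ : 4 = 2 * 2); last by ring.
  by rewrite powRM// -powRD ?pnatr_eq0 ?implybT// mulr_natl.
by field; rewrite !gt_eqF// powR_gt0.
Qed.

Theorem proposition5p6 (R : realType) (n : nat) (s gamma : R) :
  (1 <= n)%N ->
  0 < s < 1 ->
  0 < gamma ->
  (gamma%:E * \int[lebesgue_tuple R n]_z
     ((1 - cos (last 0 z)) / euclidean_norm z `^ (n%:R + 2 * s))%:E = 1)%E ->
  gamma = s * 2 `^ (2 * s) * Gamma ((n%:R + 2 * s) / 2) /
          (pi `^ (n%:R / 2) * Gamma (1 - s)).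
Proof.
case: n => // n _ s01 gamma0; have /andP[s0 _] := s01.
have := eGamma_mul_integral R n s s0.
set I := (\int[_]_z _)%E => AI gammaI.
(* [Gamma] is by conversion the finite part of [eGamma]. *)
have -> : Gamma (1 - s) = fine (eGamma R (1 - s)) by [].
have -> : Gamma ((n.+1%:R + 2 * s) / 2) =
  fine (eGamma R ((n.+1%:R + 2 * s) / 2)) by [].
have Bgt0 := eGamma_gt0 R (1 - s).
have Bfin : eGamma R (1 - s) \is a fin_num.
  by rewrite ge0_fin_numE ?ltW// eGamma_onem_lty.
have IE : I = gamma^-1%:E.
  by rewrite -[I]mul1e -(@mulVf _ gamma) ?gt_eqF// EFinM -muleA gammaI mule1.
(* Since [I] is the real number [1/gamma] and [eGamma R (1 - s)] is finite, this equation also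
   yields the convergence of Euler's integral at [(n+1+2s)/2]. *)
have {AI} : eGamma R ((n.+1%:R + 2 * s) / 2) =
    (gamma%:E * ((pi `^ (n.+1%:R / 2) / (s * 2 `^ (2 * s)))%:E *
      eGamma R (1 - s)))%E.
  by rewrite -AI IE muleCA -EFinM mulfV ?gt_eqF// mule1.
move: Bgt0; rewrite -(fineK Bfin) lte_fin; set B := fine _ => B0.
rewrite -!EFinM => -> /=.
by field; rewrite !gt_eqF// ?powR_gt0 ?pi_gt0.
Qed.
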